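(* There exist integers $r,m\ge1$, a type space $\mathcal{T}^1$ with $r$ entries in $\mathbb{R}^m$, and a symmetric $g\in\mathrm{IC}(\mathcal{T}^1,\mathcal{T}^1)$ (i.e. $g\in[m]^{r\times r}$ with $g(i,j)=g(j,i)$ for all $i,j\in[r]$) such that for every type space $\mathcal{S}^1$ with type matrix in $\mathbb{R}^{r\times m}$ satisfying $\mathrm{IC}(\mathcal{S}^1)=\mathrm{IC}(\mathcal{T}^1)$, $g$ is not an affine maximizer on $\mathcal{S}^1\times\mathcal{S}^1$, i.e. $g\notin\mathrm{AM}(\mathcal{S}^1,\mathcal{S}^1)$.
   Context: Write $[m]=\{1,\dots,m\}$. A (single-player) type space with $r$ entries is an ordered tuple $\mathcal{T}=(\mathcal{T}_1,\dots,\mathcal{T}_r)$ of vectors in $\mathbb{R}^m$; its type matrix $T\in\mathbb{R}^{r\times m}$ has these vectors as rows, in the same order. Let $\mathcal{T}^1,\dots,\mathcal{T}^n$ be type spaces in $\mathbb{R}^m$ with $r_1,\dots,r_n$ entries and type matrices $T^1,\dots,T^n$. An outcome function $g$ on $\mathcal{T}^1\times\cdots\times\mathcal{T}^n$ is identified with a tensor $g\in[m]^{r_1\times\cdots\times r_n}$, i.e. a function $[r_1]\times\cdots\times[r_n]\to[m]$, $g(i_1,\dots,i_n)$ being the outcome when player $j$ declares the $i_j$-th entry of $\mathcal{T}^j$. Incentive compatibility: $g$ is IC on $\mathcal{T}^1\times\cdots\times\mathcal{T}^n$ if there is a payment function $p:[r_1]\times\cdots\times[r_n]\to\mathbb{R}^n$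 such that for every player $j\in[n]$, every $(i_1,\dots,i_n)$, and every $l\in[r_j]$, $$T^j_{i_j,\,g(i_1,\dots,i_n)}-p(i_1,\dots,i_n)_j\ \ge\ T^j_{i_j,\,g(i_1,\dots,i_{j-1},l,i_{j+1},\dots,i_n)}-p(i_1,\dots,i_{j-1},l,i_{j+1},\dots,i_n)_j .$$ $\mathrm{IC}(\mathcal{T}^1,\dots,\mathcal{T}^n)\subseteq[m]^{r_1\times\cdots\times r_n}$ denotes the set of all IC outcome functions; the case $n=1$ defines $\mathrm{IC}(\mathcal{T})\subseteq[m]^r$ for a single type space. Affine maximizers: for $\alpha_1,\dots,\alpha_n>0$ and $\gamma\in\mathbb{R}^m$, let $M(\alpha_1\mathcal{T}^1,\dots,\alpha_n\mathcal{T}^n,\gamma)$ be the single-player type space with $\prod_j r_j$ entries, indexed lexicographically by $(i_1,\dots,i_n)$, whose $(i_1,\dots,i_n)$-th entry is $\alpha_1\mathcal{T}^1_{i_1}+\cdots+\alpha_n\mathcal{T}^n_{i_n}+\gamma$. The outcome function $g$ is an affine maximizer on $\mathcal{T}^1\times\cdots\times\mathcal{T}^n$ if there exist $\alpha_1,\dots,\alpha_n>0$ and $\gamma\in\mathbb{R}^m$ such that $g$, viewed as a vector indexed by the tuples $(i_1,\dots,i_n)$, belongs to the single-player set $\mathrm{IC}(M(\alpha_1\mathcal{T}^1,\dots,\alpha_n\mathcal{T}^n,\gamma))$. The set of all affine maximizers is $\mathrm{AM}(\mathcal{T}^1,\dots,\mathcal{T}^n)$. *)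

(* Defs.v *)
From HB Require Import structures.
From mathcomp Require Import all_boot all_order all_algebra.
From mathcomp Require Import classical_sets reals.

Set Implicit Arguments.
Unset Strict Implicit.
Unset Printing Implicit Defensive.

Import Order.TTheory GRing.Theory Num.Theory.
Local Open Scope ring_scope.
Local Open Scope classical_set_scope.

(* A type space with r entries in R^m is represented by its type matrix
   T : 'M[R]_(r, m), and an n-tuple of type spaces by a dependent family
   T : forall j : 'I_n, 'M[R]_(r j, m).  Players, entries and outcomes are
   numbered from 0. *)

Definition profile (n : nat) (r : 'I_n -> nat) :=
  {dffun forall j : 'I_n, 'I_(r j)}.

Definition outcome (n : nat) (r : 'I_n -> nat) (m : nat) :=
  {ffun profile r -> 'I_m}.

Definition deviate (n : nat) (r : 'I_n -> nat) (i : profile r) (j : 'I_n)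
    (l : 'I_(r j)) : profile r :=
  [ffun k => dfwith i l k].

Definition IC (R : realType) (n : nat) (r : 'I_n -> nat) (m : nat)
    (T : forall j : 'I_n, 'M[R]_(r j, m)) : set (outcome r m) :=
  [set g : outcome r m | exists p : profile r -> 'rV[R]_n,
     forall (j : 'I_n) (i : profile r) (l : 'I_(r j)),
       T j (i j) (g i) - p i 0 j
         >= T j (i j) (g (deviate i l)) - p (deviate i l) 0 j].

(* The case n = 1, with the tensor indexed by one-player profiles identified
   with a vector in [m]^r. *)
Definition IC1 (R : realType) (r m : nat) (T : 'M[R]_(r, m)) :
    set {ffun 'I_r -> 'I_m} :=
  [set g : {ffun 'I_r -> 'I_m} |
     IC (fun _ : 'I_1 => T)
        [ffun i : profile (fun _ : 'I_1 => r) => g (i ord0)]].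

(* The enumeration order of a {dffun ...} type is opaque, so the lexicographic
   indexing is obtained by sorting; seqlexi nat is seq nat with its
   lexicographic order. *)
Definition profile_key (n : nat) (r : 'I_n -> nat) (i : profile r) :
    seqlexi nat :=
  [seq (i j : nat) | j <- enum 'I_n].

Definition lex_profiles (n : nat) (r : 'I_n -> nat) :
    #|{: profile r}|.-tuple (profile r) :=
  sort_tuple (fun i i' => (profile_key i <= profile_key i')%O)
    (enum_tuple {: profile r}).

Definition lex_profile (n : nat) (r : 'I_n -> nat) (k : 'I_#|{: profile r}|) :
    profile r :=
  tnth (lex_profiles r) k.

Lemma card_profile (n : nat) (r : 'I_n -> nat) :
  #|{: profile r}| = (\prod_(j < n) r j)%N.
Proof.
rewrite card_dep_ffun foldrE big_image /=.
by apply: eq_bigr => j _; rewrite card_ord.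
Qed.

Lemma profile_key_inj (n : nat) (r : 'I_n -> nat) :
  injective (@profile_key n r).
Proof.
move=> i i' /eq_in_map e; apply/ffunP => j; apply: val_inj.
by apply: e; rewrite mem_enum.
Qed.

Lemma lex_profile_bij (n : nat) (r : 'I_n -> nat) :
  bijective (@lex_profile n r).
Proof.
apply: inj_card_bij; last by rewrite card_ord.
by apply/tuple_uniqP; rewrite /= sort_uniq enum_uniq.
Qed.

Lemma lex_profile_lt (n : nat) (r : 'I_n -> nat) (k k' : 'I_#|{: profile r}|) :
  (k < k')%N -> (profile_key (lex_profile k) < profile_key (lex_profile k'))%O.
Proof.
move=> kk'; rewrite lt_neqAle; apply/andP; split.
  rewrite (inj_eq (@profile_key_inj n r)) (bij_eq (lex_profile_bij r)).
  by rewrite -(inj_eq val_inj) /= ltn_eqF.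
rewrite /lex_profile !(tnth_nth (lex_profile k)) /=.
apply: (sorted_leq_nth (leT := fun i i' => (profile_key i <= profile_key i')%O));
  rewrite ?inE ?size_sort -?cardE ?ltn_ord ?(ltnW kk') //.
- by move=> x y z; apply: le_trans.
- by apply: sort_sorted => x y; apply: le_total.
Qed.

Definition mixture (R : realType) (n : nat) (r : 'I_n -> nat) (m : nat)
    (T : forall j : 'I_n, 'M[R]_(r j, m)) (alpha : 'I_n -> R)
    (gamma : 'rV[R]_m) : 'M[R]_(#|{: profile r}|, m) :=
  \matrix_(k < #|{: profile r}|)
    (\sum_(j < n) alpha j *: row (lex_profile k j) (T j) + gamma).

Definition AM (R : realType) (n : nat) (r : 'I_n -> nat) (m : nat)
    (T : forall j : 'I_n, 'M[R]_(r j, m)) : set (outcome r m) :=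
  [set g : outcome r m | exists (alpha : 'I_n -> R) (gamma : 'rV[R]_m),
     (forall j, 0 < alpha j) /\
     IC1 (mixture T alpha gamma) [ffun k => g (lex_profile k)]].

(* The profile (i, j) of two players sharing a type space with r entries. *)
Definition profile2 (r : nat) (i j : 'I_r) : profile (fun _ : 'I_2 => r) :=
  [ffun k : 'I_2 => if k == ord0 then i else j].

(* Main.v *)
Require Import Defs.
From mathcomp Require Import all_boot all_order all_algebra.
From mathcomp Require Import perm classical_sets reals.

(** The obstruction sits on the diagonal.  When all players share one type
    space [S] and all declare the same entry [i], an affine maximizer optimizes
    [(alpha_1 + ... + alpha_n) S_i + gamma], which is a positive multiple of
    [S_i] up to a shift common to all entries.  Neither change affects
    single-player incentive compatibility, so the diagonal [i |-> g (i, ..., i)]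
    of an affine maximizer on [S x ... x S] lies in [IC(S)] (lemma
    [AM_diagonal]).  Hence if the diagonal of [g] is not in [IC(T)], then [g] is
    an affine maximizer for no [S] with [IC(S) = IC(T)].

    On the other hand, incentive compatibility for two players only constrains
    the rows and columns of [g], and says nothing directly about its diagonal.
    To separate the two, arrange three entries and three outcomes in a cycle:
    type [i] values outcome [i] at 2, outcome [i - 1] at 3 and outcome [i + 1]
    at 0, and [g] is the rock-paper-scissors rule, in which [i] beats [i + 1]
    and a tie [(i, i)] gives [i].
    - Against an opponent declaring [b], only the outcomes [b] and [b - 1] can
      be reached.  Charging 0 for the first and 1 for the second makes truth
      optimal (lemma [rps_truthful]).
    - The diagonal is the identity, of total value 2 + 2 + 2, whereas rotating
      the outcomes by one step gives 3 + 3 + 3; this contradicts cyclic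
      monotonicity (lemma [IC1_perm_le]). *)

Set Implicit Arguments.
Unset Strict Implicit.
Unset Printing Implicit Defensive.

Import Order.TTheory GRing.Theory Num.Theory.
Local Open Scope ring_scope.

Section SinglePlayer.
Variables (R : realType) (r m : nat).
Implicit Types (S : 'M[R]_(r, m)) (g : {ffun 'I_r -> 'I_m}).

Lemma IC1P S g :
  IC1 S g <->
  exists q : 'I_r -> R, forall i l, S i (g l) - q l <= S i (g i) - q i.
Proof.
pose pr (i : 'I_r) : profile (fun _ : 'I_1 => r) := [ffun=> i].
have dev (x : profile (fun _ : 'I_1 => r)) (j : 'I_1) (l : 'I_r) :
    deviate x (j := j) l = pr l.
  by apply/ffunP => k; rewrite !ffunE (ord1 j) (ord1 k) dfwith_in.
split=> [[p pP]|[q qP]].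
  exists (fun i => p (pr i) 0 0) => i l.
  by have := pP 0 (pr i) l; rewrite dev !ffunE.
exists (fun x => const_mx (q (x ord0))) => j x l.
by rewrite dev !ffunE !mxE (ord1 j); apply: qP.
Qed.

(** The payments telescope along the cycles of [s]. *)
Lemma IC1_perm_le S g (s : {perm 'I_r}) :
  IC1 S g -> \sum_i S i (g (s i)) <= \sum_i S i (g i).
Proof.
case/IC1P=> q qP.
have: \sum_i (S i (g (s i)) - q (s i)) <= \sum_i (S i (g i) - q i).
  by apply: ler_sum => i _; apply: qP.
by rewrite !sumrB [X in _ <= _ - X](reindex_perm s) lerD2r.
Qed.

End SinglePlayer.

(** There has to be at least one player, for otherwise the sum of the weights,
    by which payments are divided, vanishes. *)
Lemma AM_diagonal (R : realType) (n r m : nat) (S : 'M[R]_(r, m))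
    (g : outcome (fun _ : 'I_n.+1 => r) m) :
  AM (fun _ => S) g -> IC1 S [ffun i => g [ffun=> i]].
Proof.
case=> alpha [gamma [alpha_gt0 /IC1P[q qP]]]; apply/IC1P.
have [idx _ idxK] := lex_profile_bij (fun _ : 'I_n.+1 => r).
pose A := \sum_j alpha j.
have A_gt0 : 0 < A.
  rewrite /A big_ord_recl ltr_pwDl //.
  by apply: sumr_ge0 => j _; apply: ltW.
pose d i : profile (fun _ : 'I_n.+1 => r) := [ffun=> i].
have mixE i a :
    mixture (fun _ => S) alpha gamma (idx (d i)) a = A * S i a + gamma 0 a.
  rewrite !mxE summxE mulr_suml; congr (_ + _).
  by apply: eq_bigr => j _; rewrite !mxE idxK ffunE.
exists (fun i => (q (idx (d i)) - gamma 0 (g (d i))) / A) => i l.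
rewrite !ffunE -(ler_pM2l A_gt0) !mulrBr !(mulrC A (_ / A)) !divfK ?gt_eqF //.
have := qP (idx (d i)) (idx (d l)).
by rewrite !ffunE !idxK !mixE !opprB !addrA.
Qed.

Definition rps_value (i a : 'I_3) : nat := nth 0%N [:: 2; 0; 3] (a - i)%R.

Definition rps_winner (i j : 'I_3) : 'I_3 := if i == j + 1 then j else i.

Definition rps_charge (opp a : 'I_3) : nat := (a != opp).

Lemma rps_winnerC : commutative rps_winner.
Proof.
by case=> [[|[|[|]]] // ?] [[|[|[|]]] // ?]; apply: val_inj.
Qed.

(** Against [b], declaring [b - 1] moves the outcome from [b] to [b - 1].  The
    gain is 1 for type [b], 2 for type [b - 1] and negative for type [b + 1],
    so that any charge between 1 and 2 is right. *)
Lemma rps_truthful (a b l : 'I_3) :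
  (rps_value a (rps_winner l b) + rps_charge b (rps_winner a b)
   <= rps_value a (rps_winner a b) + rps_charge b (rps_winner l b))%N.
Proof.
by case: a b l => [[|[|[|]]] // ?] [[|[|[|]]] // ?] [[|[|[|]]] // ?].
Qed.

Definition rps_types (R : realType) : 'M[R]_3 :=
  \matrix_(i, a) (rps_value i a)%:R.

Definition rps_outcome : outcome (fun _ : 'I_2 => 3%N) 3 :=
  [ffun x : profile (fun _ : 'I_2 => 3%N) => rps_winner (x ord0) (x ord_max)].

Lemma rps_outcome_IC (R : realType) :
  IC (fun _ : 'I_2 => rps_types R) rps_outcome.
Proof.
pose opp (j : 'I_2) := rev_ord j.
have gE (x : profile (fun _ : 'I_2 => 3%N)) j :
    rps_outcome x = rps_winner (x j) (x (opp j)).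
  rewrite ffunE; case: j => [[|[|]]] // lt_j.
    by congr (rps_winner (x _) (x _)); apply: val_inj.
  by rewrite rps_winnerC; congr (rps_winner (x _) (x _)); apply: val_inj.
exists (fun x : profile (fun _ : 'I_2 => 3%N) =>
  \row_j (rps_charge (x (opp j)) (rps_outcome x))%:R) => j x l.
have opp_j : j != opp j by case: j {l} => [[|[|]]].
rewrite !mxE !(gE _ j) !ffunE dfwith_in dfwith_out //.
by rewrite lerBlDr addrAC lerBrDr -!natrD ler_nat rps_truthful.
Qed.

Lemma rps_diagonal_notIC1 (R : realType) :
  ~ IC1 (rps_types R) [ffun i => rps_outcome [ffun=> i]].
Proof.
move/(@IC1_perm_le _ _ _ _ _ (perm (addIr (- 1)))).
have -> : [ffun i => rps_outcome [ffun=> i]] = [ffun i => i].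
  by apply/ffunP => i; rewrite !ffunE /rps_winner if_same.
under eq_bigr do rewrite mxE ffunE permE.
under [X in _ <= X]eq_bigr do rewrite mxE ffunE.
by rewrite -!natr_sum ler_nat !big_ord_recl !big_ord0.
Qed.

Theorem theorem1p3 (R : realType) :
  exists (r m : nat) (T : 'M[R]_(r, m))
      (g : outcome (fun _ : 'I_2 => r) m),
    (1 <= r)%N /\ (1 <= m)%N /\
    IC (fun _ : 'I_2 => T) g /\
    (forall i j : 'I_r, g (profile2 i j) = g (profile2 j i)) /\
    (forall S : 'M[R]_(r, m),
       IC1 S = IC1 T -> ~ AM (fun _ : 'I_2 => S) g).
Proof.
exists 3%N, 3%N, (rps_types R), rps_outcome.
do 2![split=> //]; split; first exact: rps_outcome_IC.
split=> [i j|S IC_ST /AM_diagonal].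
  by rewrite !ffunE rps_winnerC.
by rewrite IC_ST; apply: rps_diagonal_notIC1.
Qed.
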